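(* Let $S=(\mathcal B;R,E)$ be a linear rewriting system modulo. If $S^+$ is convergent modulo $E$ and if $E$ is scalar-coherent on the set $\mathcal B\mathrm{NF}_S$ of monomial $S$-normal forms, then the module $\langle\mathcal B\rangle_\Bbbk/\langle R\sqcup E\rangle_\Bbbk$ presented by $S$ is free, and any choice of representatives of the projective $E$-congruence classes in $\mathcal B\mathrm{NF}_S$ defines a basis of it.
   Context: $\Bbbk$ is a commutative ring with group of units $\Bbbk^\times$, $\mathcal B$ is a set whose elements are called monomials, $\langle\mathcal B\rangle_\Bbbk$ is the free $\Bbbk$-module on $\mathcal B$, and $\mathrm{supp}(v)\subset\mathcal B$ is the support of a vector $v$. A linear 1-polygraph on $\mathcal B$ is a set of relations $r$, each with a source $s(r)$ and target $t(r)$ in $\langle\mathcal B\rangle_\Bbbk$. A linear rewriting system modulo $S=(\mathcal B;R,E)$ consists of two linear 1-polygraphs $R,E$ on $\mathcal B$ such that: - $E$ is monomial-invertible: for each $e\in E$, $s(e)\in\mathcal B$ and $t(e)=\lambda b'$ with $\lambda\in\Bbbk^\times$, $b'\in\mathcal B$; - $R$ is $E$-adapted: for each $r\in R$, $s(r)\in\mathcal B$ and $s(r)\notin\mathrm{projsupp}_E(t(r))$. Here $u\sim_E v$ ($E$-congruence) means that $u-v$ lies in the submodule spanned by the $s(e)-t(e)$, $e\in E$. Monomials $b,b'$ are projectively $E$-congruent if $b\sim_E\lambda b'$ for some $\lambda\in\Bbbk^\times$, and $\mathrm{projsupp}_E(v)$ is the set of monomials projectively $E$-congruent to some element of $\mathrm{supp}(v)$.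 $\langle\mathcal B\rangle_\Bbbk/\langle R\sqcup E\rangle_\Bbbk$ denotes the quotient of $\langle\mathcal B\rangle_\Bbbk$ by the submodule spanned by the $s(r)-t(r)$, $r\in R\sqcup E$. An $S$-rewriting step is a composite $u\sim_E\lambda s(r)+v\dashrightarrow\lambda t(r)+v\sim_E w$ with $\lambda\in\Bbbk\setminus\{0\}$, $r\in R$, $v\in\langle\mathcal B\rangle_\Bbbk$; it is positive if $s(r)\notin\mathrm{projsupp}_E(v)$. $S^+$ denotes the set of positive steps. A positive rewriting sequence is either an $E$-congruence or a finite composite of positive steps. $S^+$ is confluent if for any two positive rewriting sequences with the same source $u$ and targets $v,v'$, there are positive rewriting sequences from $v$ and from $v'$ to a common target; it is terminating modulo $E$ if there is no infinite sequence of composable positive steps; it is convergent modulo $E$ if it is both. A monomial $S$-normal form is a monomial $b$ which is not projectively $E$-congruent to $s(r)$ for any $r\in R$; their set is $\mathcal B\mathrm{NF}_S$. $E$ (regarded as an abstract rewriting system in which each relation $b\to\lambda b'$ carries the scalar $\lambda$) is scalar-coherent on $\mathcal B\mathrm{NF}_S$ if for all $b\in\mathcal B\mathrm{NF}_S$ and $\lambda\in\Bbbk$, $b\sim_E\lambda b$ implies $\lambda=1$. *)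

(* Defs.v *)
From HB Require Import structures.
From Stdlib Require Import Relation_Operators.
From mathcomp Require Import all_boot all_order all_algebra.
From mathcomp Require Import boolp classical_sets.
From mathcomp Require Import finmap monalg.

Set Implicit Arguments.
Unset Strict Implicit.
Unset Printing Implicit Defensive.

Import GRing.Theory.
Local Open Scope ring_scope.
Local Open Scope quotient_scope.
Local Open Scope classical_set_scope.

Section Module.
Variables (k : nzRingType) (V : lmodType k).

Definition lin_span (I : Type) (f : I -> V) : set V :=
  [set v | exists s : seq (k * I), v = \sum_(p <- s) p.1 *: f p.2].

Definition in_span (I : Type) (f : I -> V) : {pred V} := fun v => `[< lin_span f v >].

Lemma in_span_submod_closed (I : Type) (f : I -> V) :
  GRing.submod_closed (in_span f).
Proof.
split=> [|a u v].
  by rewrite unfold_in; apply/asboolP; exists [::]; rewrite big_nil.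
rewrite !unfold_in => /asboolP [s ->] /asboolP [t ->]; apply/asboolP.
exists ([seq (a * p.1, p.2) | p <- s] ++ t).
rewrite big_cat big_map scaler_sumr; congr (_ + _).
by apply: eq_bigr => p _; rewrite scalerA.
Qed.

HB.instance Definition _ (I : Type) (f : I -> V) :=
  GRing.isSubmodClosed.Build k V (in_span f) (in_span_submod_closed f).

Section SpanQuotient.
Variables (I : Type) (f : I -> V).
Local Notation quot := (Quotient.quot (in_span f)).

(* The quotient of V by the span of f: the Z-module quotient of MathComp's
   ring_quotient, to which the scalar action is added. *)
Definition span_quot : Type := quot.

HB.instance Definition _ := GRing.Zmodule.copy span_quot quot.

Definition quot_map (v : V) : span_quot := \pi_quot v.

Definition quot_scale (a : k) (x : span_quot) : span_quot :=
  quot_map (a *: repr (x : quot)).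

Lemma quot_mapP u v : quot_map u = quot_map v <-> lin_span f (u - v).
Proof.
rewrite /quot_map; split=> [/eqP|uv].
  by rewrite -Quotient.idealrBE => /asboolP.
by apply/eqP; rewrite -Quotient.idealrBE; apply/asboolP.
Qed.

Lemma quot_map_surj x : exists v, quot_map v = x.
Proof. by exists (repr (x : quot)); rewrite /quot_map reprK. Qed.

Lemma quot_mapD : {morph quot_map : u v / u + v}.
Proof. by move=> u v; rewrite /quot_map -raddfD. Qed.

Lemma quot_mapZ a v : quot_scale a (quot_map v) = quot_map (a *: v).
Proof.
apply/quot_mapP/asboolP; rewrite -scalerBr.
apply: (rpredZ (s := in_span f)); apply/asboolP/quot_mapP.
by rewrite /quot_map reprK.
Qed.

Lemma quot_scaleA a b x : quot_scale a (quot_scale b x) = quot_scale (a * b) x.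
Proof. by have [v <-] := quot_map_surj x; rewrite !quot_mapZ scalerA. Qed.

Lemma quot_scale1 : left_id 1 quot_scale.
Proof. by move=> x; have [v <-] := quot_map_surj x; rewrite quot_mapZ scale1r. Qed.

Lemma quot_scaleDr : right_distributive quot_scale +%R.
Proof.
move=> a x y; have [u <-] := quot_map_surj x; have [v <-] := quot_map_surj y.
by rewrite -quot_mapD !quot_mapZ -quot_mapD scalerDr.
Qed.

Lemma quot_scaleDl x : {morph quot_scale^~ x : a b / a + b}.
Proof.
move=> a b; have [v <-] := quot_map_surj x.
by rewrite !quot_mapZ -quot_mapD scalerDl.
Qed.

HB.instance Definition _ := GRing.Zmodule_isLmodule.Build k span_quot
  quot_scaleA quot_scale1 quot_scaleDr quot_scaleDl.

End SpanQuotient.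

Definition lin_comb (I : choiceType) (f : I -> V) (c : {malg k[I]}) : V :=
  \sum_(i <- msupp c) c@_i *: f i.

Definition is_basis (I : choiceType) (f : I -> V) : Prop :=
  (forall c, lin_comb f c = 0 -> c = 0) /\ (forall v, exists c, lin_comb f c = v).

Definition is_free : Prop := exists (I : choiceType) (f : I -> V), is_basis f.

End Module.

Section Rewriting.
Variables (k : comUnitRingType) (B : choiceType).
Local Notation vect := {malg k[B]}.

Record linear_polygraph := LinearPolygraph {
  relation : Type;
  source : relation -> vect;
  target : relation -> vect
}.

Definition polygraph_sum (P Q : linear_polygraph) := {|
  relation := relation P + relation Q;
  source r := match r with inl p => source p | inr q => source q end;
  target r := match r with inl p => target p | inr q => target q end
|}.

Definition defect (P : linear_polygraph) (r : relation P) : vect :=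
  source r - target r.

Definition congruent (E : linear_polygraph) (u v : vect) : Prop :=
  lin_span (@defect E) (u - v).

Definition proj_congruent (E : linear_polygraph) (b b' : B) : Prop :=
  exists2 lam : k, lam \is a GRing.unit & congruent E << b >> << lam *g b' >>.

Definition projsupp (E : linear_polygraph) (v : vect) : set B :=
  [set b | exists2 b', b' \in msupp v & proj_congruent E b b'].

Definition monomial_invertible (E : linear_polygraph) : Prop :=
  forall e : relation E, exists b b' : B, exists lam : k,
    [/\ lam \is a GRing.unit, source e = << b >> & target e = << lam *g b' >>].

Definition adapted (E R : linear_polygraph) : Prop :=
  forall r : relation R,
    exists2 b : B, source r = << b >> & ~ projsupp E (target r) b.

Definition scalar_coherent (E : linear_polygraph) (X : set B) : Prop :=
  forall b lam, X b -> congruent E << b >> << lam *g b >> -> lam = 1.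

Record rewriting_modulo := RewritingModulo {
  rules : linear_polygraph;
  modulo : linear_polygraph;
  modulo_invertible : monomial_invertible modulo;
  rules_adapted : adapted modulo rules
}.

Variable S : rewriting_modulo.
Local Notation R := (rules S).
Local Notation E := (modulo S).

(* The composite  u ~ lam s(r) + v --> lam t(r) + v ~ w. *)
Definition step_via (lam : k) (r : relation R) (v u w : vect) : Prop :=
  [/\ lam != 0, congruent E u (lam *: source r + v)
    & congruent E (lam *: target r + v) w].

Definition positive_step (u w : vect) : Prop :=
  exists lam r v, step_via lam r v u w /\
    exists2 b : B, source r = << b >> & ~ projsupp E v b.

Definition positive_seq (u w : vect) : Prop :=
  congruent E u w \/ clos_trans _ positive_step u w.

Definition positive_confluent : Prop :=
  forall u v v', positive_seq u v -> positive_seq u v' ->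
    exists2 w, positive_seq v w & positive_seq v' w.

Definition positive_terminating : Prop :=
  ~ exists u : nat -> vect, forall n, positive_step (u n) (u n.+1).

Definition positive_convergent : Prop :=
  positive_confluent /\ positive_terminating.

Definition monomial_nf : set B :=
  [set b | ~ exists (r : relation R) (b' : B),
             source r = << b' >> /\ proj_congruent E b b'].

Definition presented_module : lmodType k :=
  span_quot (@defect (polygraph_sum R E)).

Definition presented_class (v : vect) : presented_module :=
  quot_map (@defect (polygraph_sum R E)) v.

(* T contains exactly one monomial of each class in monomial_nf, which is a
   union of classes as E is monomial-invertible. *)
Definition nf_representatives (T : set B) : Prop :=
  T `<=` monomial_nf /\
  forall b, monomial_nf b -> exists! b', T b' /\ proj_congruent E b b'.

End Rewriting.

(* Main.v *)
Require Import Defs.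
From HB Require Import structures.
From Stdlib Require Import Relation_Operators.
From mathcomp Require Import all_boot all_order all_algebra.
From mathcomp Require Import boolp classical_sets.
From mathcomp Require Import finmap monalg.

(* Termination of [S^+] forces scalar-coherence on reducible monomials as well,
   so no nonzero multiple of a monomial is E-congruent to 0, and every projective
   E-class has a linear coordinate that is constant on E-congruence classes.
   Splitting [u = c s(r) + v] along the coordinate of [s(r)] shows that [u] and
   [u + a (s(r) - t(r))] both reduce positively to [c t(r) + v]; by confluence,
   vectors equal in the presented module are joinable. A combination of normal
   forms admits no positive step, whence independence. A vector admitting no
   positive step has zero coordinate on every reducible class, whence generation. *)

Set Implicit Arguments.
Unset Strict Implicit.
Unset Printing Implicit Defensive.

Import GRing.Theory.
Local Open Scope ring_scope.

(** * Linearity of the projection onto the quotient by a span *)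

Section QuotMap.
Variables (k : nzRingType) (V : lmodType k) (I : Type) (f : I -> V).

Lemma quot_map_is_linear : linear (quot_map f).
Proof. by move=> a u v; rewrite quot_mapD -quot_mapZ. Qed.

Lemma quot_map_scale a v : quot_map f (a *: v) = a *: quot_map f v.
Proof. by rewrite -quot_mapZ. Qed.

HB.instance Definition _ :=
  GRing.isLinear.Build k V (span_quot f) *:%R (quot_map f) quot_map_is_linear.

Lemma linear_span_eq0 (W : lmodType k) (g : {linear V -> W}) v :
  (forall i, g (f i) = 0) -> lin_span f v -> g v = 0.
Proof.
move=> gf0 [s ->]; rewrite linear_sum big1 // => p _.
by rewrite linearZ /= gf0 scaler0.
Qed.

End QuotMap.

(** * Linear combinations as linear maps on a free module *)

Section LinComb.
Variables (k : comNzRingType) (I : choiceType).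
Implicit Type c : {malg k[I]}.

Lemma malgUZ (a : k) (i : I) : << a *g i >> = a *: << i >> :> {malg k[I]}.
Proof. by apply/malgP => j; rewrite mcoeffZ !mcoeffU mulrnAr mulr1. Qed.

Section Fixed.
Variables (V : lmodType k) (f : I -> V).

Lemma lin_combEw c (d : {fset I}) : (msupp c `<=` d)%fset ->
  lin_comb f c = \sum_(i <- d) c@_i *: f i.
Proof.
move=> cd; rewrite /lin_comb (big_fset_incl _ cd) // => i _ /mcoeff_outdom ->.
by rewrite scale0r.
Qed.

Lemma lin_comb_is_linear : linear (lin_comb f).
Proof.
(* Supports vary with the vector; one finite set containing all three lets the sums be compared term
   by term. *)
move=> a u v; set d := (msupp u `|` msupp v `|` msupp (a *: u + v))%fset.
have ud : (msupp u `<=` d)%fset by rewrite /d -fsetUA fsubsetUl.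
have vd : (msupp v `<=` d)%fset by rewrite /d fsetUAC fsubsetUr.
have wd : (msupp (a *: u + v) `<=` d)%fset by rewrite fsubsetUr.
rewrite (lin_combEw ud) (lin_combEw vd) (lin_combEw wd) scaler_sumr -big_split.
by apply: eq_bigr => i _; rewrite mcoeffD mcoeffZ scalerDl scalerA.
Qed.

HB.instance Definition _ :=
  GRing.isLinear.Build k {malg k[I]} V *:%R (lin_comb f) lin_comb_is_linear.

Lemma lin_combU i : lin_comb f << i >> = f i.
Proof.
rewrite (lin_combEw msuppU_le) big_seq_fset1 mcoeffUU.
by rewrite scale1r.
Qed.

Lemma linear_lin_comb (W : lmodType k) (g : {linear V -> W}) c :
  g (lin_comb f c) = lin_comb (g \o f) c.
Proof. by rewrite linear_sum; apply: eq_bigr => i _; rewrite linearZ. Qed.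

End Fixed.

Lemma lin_comb_monomials c : lin_comb (fun i => << i >> : {malg k[I]}) c = c.
Proof. by rewrite {2}[c]monalgE; apply: eq_bigr => i _; rewrite malgUZ. Qed.

Lemma linear_malgE (W : lmodType k) (g : {linear {malg k[I]} -> W}) c :
  g c = lin_comb (fun i => g << i >>) c.
Proof. by rewrite -{1}[c]lin_comb_monomials linear_lin_comb. Qed.

End LinComb.

(** * The quotient by E and coordinates along projective E-classes *)

Section Congruence.
Variables (k : comUnitRingType) (B : choiceType) (E : linear_polygraph k B).
Implicit Types (a lam mu : k) (b x y : B) (u v w : {malg k[B]}).

(* The quotient by E is sealed, as the unifier tends to unfold [span_quot]. *)
Fact congruence_quotient : {W : lmodType k &
  {g : {linear {malg k[B]} -> W} | forall u v, congruent E u v <-> g u = g v}}.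
Proof.
exists (span_quot (@defect k B E)), (quot_map (@defect k B E)) => u v.
by split=> /quot_mapP.
Qed.

Definition congruence_module : lmodType k := projT1 congruence_quotient.

Definition congruence_class : {linear {malg k[B]} -> congruence_module} :=
  sval (projT2 congruence_quotient).

Local Notation q := congruence_class.

Lemma congruentP u v : congruent E u v <-> q u = q v.
Proof. exact: svalP (projT2 congruence_quotient) u v. Qed.

Lemma congruence_classU lam b : q << lam *g b >> = lam *: q << b >>.
Proof. by rewrite [in LHS]malgUZ linearZ_LR. Qed.

Lemma congruence_class_malgEw v (d : {fset B}) : (msupp v `<=` d)%fset ->
  q v = \sum_(x <- d) v@_x *: q << x >>.
Proof. by move=> vd; rewrite [LHS]linear_malgE (lin_combEw _ vd). Qed.

Lemma proj_congruentP x b : proj_congruent E x b <->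
  exists2 lam, lam \is a GRing.unit & q << x >> = lam *: q << b >>.
Proof.
by split=> -[lam lamU h]; exists lam => //; move: h; rewrite congruentP congruence_classU.
Qed.

Lemma congruent_refl v : congruent E v v.
Proof. exact/congruentP. Qed.

Lemma proj_congruent_refl b : proj_congruent E b b.
Proof. by apply/proj_congruentP; exists 1; rewrite ?unitr1 ?scale1r. Qed.

Lemma proj_congruent_sym x b : proj_congruent E x b -> proj_congruent E b x.
Proof.
move=> /proj_congruentP [lam lamU h]; apply/proj_congruentP.
by exists lam^-1; rewrite ?unitrV // h scalerA mulVr ?scale1r.
Qed.

Lemma proj_congruent_trans x y b :
  proj_congruent E x y -> proj_congruent E y b -> proj_congruent E x b.
Proof.
move=> /proj_congruentP [lam lamU h] /proj_congruentP [mu muU h'].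
by apply/proj_congruentP; exists (lam * mu); rewrite ?unitrM ?lamU // h h' scalerA.
Qed.

Lemma projsuppD u v b :
  projsupp E (u + v) b -> projsupp E u b \/ projsupp E v b.
Proof.
case=> x /(fsubsetP (msuppD_le _ _)); rewrite in_fsetU => /orP[] xs xb;
  by [left; exists x | right; exists x].
Qed.

Lemma projsuppZ a v b : projsupp E (a *: v) b -> projsupp E v b.
Proof. by case=> x /(fsubsetP (msuppZ_le _ _)) xs xb; exists x. Qed.

(** The scalar is picked by choice and is determined only once no nonzero multiple of [b] is
    E-congruent to 0. The default 0 discards monomials outside the class of [b]. *)
Definition proj_scalar b x : k^o :=
  if pselect (proj_congruent E x b) is left h then sval (cid2 h) else 0.

Lemma proj_scalarE b x : proj_congruent E x b ->
  q << x >> = proj_scalar b x *: q << b >>.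
Proof.
rewrite /proj_scalar; case: pselect => // h _; case: cid2 => lam _ /=.
by by rewrite congruentP congruence_classU.
Qed.

Lemma proj_scalar0 b x : ~ proj_congruent E x b -> proj_scalar b x = 0.
Proof. by rewrite /proj_scalar; case: pselect. Qed.

(* When no nonzero multiple of [b] is E-congruent to 0, this is the coordinate
   along the projective class of [b] in the quotient by E. *)
Definition class_coord b : {malg k[B]} -> k^o := lin_comb (proj_scalar b).

HB.instance Definition _ b := GRing.Linear.on (class_coord b).

Lemma class_coordU b x : class_coord b << x >> = proj_scalar b x.
Proof. exact: lin_combU. Qed.

Lemma class_coordUZ b lam x : class_coord b << lam *g x >> = lam *: proj_scalar b x.
Proof. by rewrite malgUZ linearZ /= class_coordU. Qed.

Lemma class_coord0 b v : ~ projsupp E v b -> class_coord b v = 0.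
Proof.
move=> bv; rewrite /class_coord /lin_comb big_seq big1 // => x xv.
rewrite proj_scalar0 ?scaler0 // => /proj_congruent_sym xb.
by apply: bv; exists x.
Qed.

(** Take for [v'] the vector [v] with all monomials of the class of [b] deleted; modulo E these add
    up to a multiple of [b]. The support inclusion serves an induction on the size of the
    support. *)
Lemma class_coord_decomposition b v : exists v',
  [/\ congruent E v (class_coord b v *: << b >> + v'), ~ projsupp E v' b
    & forall x, x \in msupp v' -> x \in msupp v].
Proof.
pose v' : {malg k[B]} :=
  [malg x in msupp v => if `[< proj_congruent E x b >] then 0 else v@_x].
have v'E x : v'@_x = if `[< proj_congruent E x b >] then 0 else v@_x.
  by rewrite mcoeffE; case: msuppP => //; case: ifP.
have v'v : (msupp v' `<=` msupp v)%fset.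
  by apply/fsubsetP => x; rewrite -!mcoeff_neq0 v'E; case: ifP; rewrite ?eqxx.
exists v'; split; last exact/fsubsetP.
  apply/congruentP; rewrite linearD linearZ_LR.
  rewrite (congruence_class_malgEw (fsubset_refl _)) (congruence_class_malgEw v'v).
  rewrite /class_coord /lin_comb scaler_suml -big_split.
  apply: eq_bigr => x _ /=; rewrite v'E -scalerA; case: asboolP => [xb | xb].
    by rewrite (proj_scalarE xb) scale0r addr0.
  by rewrite (proj_scalar0 xb) scale0r scaler0 add0r.
case=> x; rewrite -mcoeff_neq0 v'E; case: asboolP; first by rewrite eqxx.
by move=> xb _ /proj_congruent_sym.
Qed.

Section Torsionfree.
Hypothesis E_inv : monomial_invertible E.
Variable b : B.
Hypothesis b_tf : forall mu, congruent E (mu *: << b >>) 0 -> mu = 0.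

(** Two admissible scalars differ by a scalar killing the class of [b], which is 0 by [b_tf]. *)
Lemma proj_scalar_eq x mu : q << x >> = mu *: q << b >> ->
  proj_congruent E x b -> proj_scalar b x = mu.
Proof.
move=> h xb; apply/eqP; rewrite -subr_eq0; apply/eqP/b_tf/congruentP.
rewrite linearZ_LR scalerBl -h -proj_scalarE //.
by rewrite subrr linear0.
Qed.

Lemma proj_scalar1 : proj_scalar b b = 1.
Proof. by apply: proj_scalar_eq (proj_congruent_refl b); rewrite scale1r. Qed.

(** By linearity it suffices to kill each [s(e) - t(e)]. Its two monomials are projectively
    congruent, so both lie outside the class of [b] or both inside, where uniqueness of the scalar
    applies. *)
Lemma class_coord_congruent u v : congruent E u v -> class_coord b u = class_coord b v.
Proof.
move=> uv; apply/eqP; rewrite -subr_eq0 -linearB; apply/eqP.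
apply: linear_span_eq0 uv => e; have [x [y [lam [lamU s t]]]] := E_inv e.
have xy : q << x >> = lam *: q << y >>.
  have /congruentP : congruent E (source e) (target e).
    by exists [:: (1, e)]; rewrite big_seq1 scale1r.
  by rewrite s t congruence_classU.
have pxy : proj_congruent E x y by apply/proj_congruentP; exists lam.
rewrite /defect s t linearB /= class_coordU class_coordUZ.
have [yb|yb] := pselect (proj_congruent E y b); last first.
  rewrite !proj_scalar0 ?scaler0 ?subrr // => xb; apply: yb.
  exact: proj_congruent_trans (proj_congruent_sym pxy) xb.
apply/eqP; rewrite subr_eq0; apply/eqP/proj_scalar_eq.
  by rewrite xy (proj_scalarE yb) scalerA.
exact: proj_congruent_trans yb.
Qed.

End Torsionfree.
End Congruence.

(** * Positive sequences and their compatibility with E-congruence *)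

Section Rewriting.
Variables (k : comUnitRingType) (B : choiceType) (S : rewriting_modulo k B).
Local Notation R := (rules S).
Local Notation E := (modulo S).
Local Notation q := (congruence_class E).
Implicit Types (b x y : B) (u v w : {malg k[B]}) (r : relation R).

Lemma positive_step_congruent u' w' u w :
  congruent E u u' -> positive_step S u' w' -> congruent E w' w ->
  positive_step S u w.
Proof.
rewrite !congruentP => uu' [lam [r [v [[lam0 uv vw] bv]]]] w'w.
exists lam, r, v; split=> //; split=> //.
  by move: uv; rewrite !congruentP uu'.
by move: vw; rewrite !congruentP w'w.
Qed.

Lemma positive_seq_refl u : positive_seq S u u.
Proof. by left; apply: congruent_refl. Qed.

Lemma positive_step_seq u w : positive_step S u w -> positive_seq S u w.
Proof. by move=> uw; right; apply: t_step. Qed.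

Lemma positive_trans_congruentl u' u w : congruent E u u' ->
  clos_trans _ (positive_step S) u' w -> clos_trans _ (positive_step S) u w.
Proof.
move=> uu' u'w; elim: u'w u uu' => {u' w} [u' w u'w u uu' | u' v w _ IHuv vw _ u uu'].
  by apply: t_step; apply: positive_step_congruent uu' u'w _; apply: congruent_refl.
by apply: t_trans vw; apply: IHuv.
Qed.

Lemma positive_trans_congruentr w' u w : congruent E w' w ->
  clos_trans _ (positive_step S) u w' -> clos_trans _ (positive_step S) u w.
Proof.
move=> w'w uw'; elim: uw' w w'w => {u w'} [u w' uw' w w'w | u v w' uv _ _ IHvw w w'w].
  by apply: t_step; apply: positive_step_congruent uw' w'w; apply: congruent_refl.
by apply: t_trans uv _; apply: IHvw.
Qed.

Lemma positive_seq_trans u v w :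
  positive_seq S u v -> positive_seq S v w -> positive_seq S u w.
Proof.
case=> uv [] vw.
- by left; move: uv vw; rewrite !congruentP => ->.
- by right; apply: positive_trans_congruentl uv vw.
- by right; apply: positive_trans_congruentr vw uv.
- by right; apply: t_trans uv vw.
Qed.

Lemma monomial_nf_proj_congruent x y :
  proj_congruent E x y -> monomial_nf S x -> monomial_nf S y.
Proof.
move=> xy xnf [r [b' [sr yb']]]; apply: xnf.
by exists r, b'; split=> //; apply: proj_congruent_trans yb'.
Qed.

Lemma not_monomial_nf b : ~ monomial_nf S b ->
  exists r b', source r = << b' >> /\ proj_congruent E b b'.
Proof. by move=> /contrapT. Qed.

(* If [mu *: s(r)] is E-congruent to 0 with [mu != 0], then
   [0 ~ mu s(r) --> mu t(r) ~ mu s(r) + mu t(r) --> 2 mu t(r) ~ ...] is an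
   infinite sequence of positive steps, as [R] is adapted. *)
Lemma source_torsionfree r b mu : positive_terminating S ->
  source r = << b >> -> congruent E (mu *: << b >>) 0 -> mu = 0.
Proof.
move=> term sr /congruentP mub; apply: contrapT => /eqP mu0; apply: term.
exists (fun n => n%:R *: (mu *: target r)) => n.
exists mu, r, (n%:R *: (mu *: target r)); split.
  split=> //; apply/congruentP.
    by rewrite sr linearD mub linear0 add0r.
  by rewrite -natr1 scalerDl scale1r addrC.
exists b => // /projsuppZ /projsuppZ; have [b' sr' nb'] := rules_adapted r.
suff -> : b = b' by [].
have : b \in msupp (<< b' >> : {malg k[B]}) by rewrite -sr' sr msuppU oner_eq0 inE.
by rewrite msuppU oner_eq0 inE => /eqP.
Qed.

(** * Torsion-freeness of monomials and irreducible vectors *)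

Section Convergent.
Hypothesis S_term : positive_terminating S.
Hypothesis E_coh : scalar_coherent E (monomial_nf S).

(** For a normal form, [b] is E-congruent to [(1 - mu) b], so coherence gives [1 - mu = 1]. A
    reducible [b] is a unit multiple of a source modulo E, where termination applies. *)
Lemma monomial_torsionfree b mu : congruent E (mu *: << b >>) 0 -> mu = 0.
Proof.
move=> /congruentP mub; have [bnf|] := pselect (monomial_nf S b).
  suff : 1 - mu = 1 by move/eqP; rewrite subr_eq addrC -subr_eq subrr => /eqP.
  apply: E_coh bnf _; apply/congruentP.
  by rewrite congruence_classU scalerBl scale1r -linearZ_LR mub linear0 subr0.
move=> /not_monomial_nf [r [b' [sr /proj_congruentP [lam lamU bb']]]].
suff mulam : mu * lam = 0 by apply: (mulIr lamU); rewrite mul0r.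
apply: source_torsionfree S_term sr _; apply/congruentP.
by rewrite -mub !linearZ_LR bb' scalerA.
Qed.

Lemma modulo_class_coord_congruent b u v : congruent E u v -> class_coord E b u = class_coord E b v.
Proof.
exact/class_coord_congruent/(@monomial_torsionfree b)/(@modulo_invertible _ _ S).
Qed.

Lemma class_coord_monomial b : class_coord E b << b >> = 1.
Proof. by rewrite class_coordU proj_scalar1 //; apply: monomial_torsionfree. Qed.

(** Stated on coordinates rather than on the support, since reducible monomials in the support may
    cancel modulo E. *)
Definition irreducible v := forall b, ~ monomial_nf S b -> class_coord E b v = 0.

(** In a positive step the remainder avoids the class of the source, so the coordinate of [v] there
    is the nonzero coefficient of the step. *)
Lemma irreducible_nostep v w : irreducible v -> ~ positive_step S v w.
Proof.
move=> v_irr [lam [r [v' [[lam0 vE _] [b sr bv']]]]].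
have bnf : ~ monomial_nf S b.
  by apply; exists r, b; split=> //; apply: proj_congruent_refl.
move/eqP: lam0; apply; rewrite -(v_irr b bnf) (modulo_class_coord_congruent b vE).
by rewrite sr linearP /= class_coord_monomial (class_coord0 bv') addr0 [RHS]mulr1.
Qed.

Lemma irreducible_seq v w : irreducible v -> positive_seq S v w -> congruent E v w.
Proof.
move=> v_irr [//|]; suff step_of : clos_trans _ (positive_step S) v w ->
    exists w', positive_step S v w'.
  by move=> /step_of [w' /(irreducible_nostep v_irr)].
by elim=> {v_irr v w} [v w vw | //]; exists w.
Qed.

Lemma nostep_irreducible v : ~ (exists w, positive_step S v w) -> irreducible v.
Proof.
move=> nostep b /not_monomial_nf [r [b' [sr bb']]].
apply: contrapT => /eqP cb0; apply: nostep.
have [v' [/congruentP vE bv' _]] := class_coord_decomposition E b v.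
have /proj_congruentP [lam lamU qb] := bb'.
(* The coordinate splits off [b], and the unit [lam] converts [b] into the source of [r]; the
   product stays nonzero. *)
exists ((class_coord E b v * lam) *: target r + v'), (class_coord E b v * lam), r, v'.
split; last first.
  exists b' => // -[x xv' b'x]; apply: bv'; exists x => //.
  exact: proj_congruent_trans b'x.
split; last exact: congruent_refl.
  by rewrite mulIr_eq0 //; apply: mulIr.
apply/congruentP; rewrite vE sr 2!linearD 2!linearZ_LR qb.
by rewrite scalerA.
Qed.

End Convergent.

(** * Joinability and equality in the presented module *)

Definition joinable u v := exists2 w, positive_seq S u w & positive_seq S v w.

Lemma joinable_trans : positive_confluent S ->
  forall u v w, joinable u v -> joinable v w -> joinable u w.
Proof.
move=> conf u v w [x ux vx] [y vy wy]; have [z xz yz] := conf _ _ _ vx vy.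
by exists z; [apply: positive_seq_trans xz | apply: positive_seq_trans yz].
Qed.

(** A zero coefficient is allowed, the sequence then being an identity; this covers vanishing [c] or
    [a + c] in [joinable_rule]. *)
Lemma positive_seq_rule r b a v : source r = << b >> -> ~ projsupp E v b ->
  positive_seq S (a *: source r + v) (a *: target r + v).
Proof.
move=> sr bv; have [->|a0] := eqVneq a 0.
  by rewrite !scale0r; apply: positive_seq_refl.
apply: positive_step_seq; exists a, r, v; split; last by exists b.
by split=> //; apply: congruent_refl.
Qed.

(** If [u] is E-congruent to [c s(r) + v], then [u + a (s(r) - t(r))] is E-congruent to
    [(a + c) s(r) + (v - a t(r))]. As R is adapted, [v - a t(r)] avoids the class of [s(r)], so the
    rule applies positively and yields [c t(r) + v]. *)
Lemma joinable_rule u a r : joinable (u + a *: defect r) u.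
Proof.
have [b sr bt] := rules_adapted r.
have [v [/congruentP uE bv _]] := class_coord_decomposition E b u.
move: (class_coord E b u : k) uE => c uE.
exists (c *: target r + v); last first.
  apply: positive_seq_trans (positive_seq_rule c sr bv); left.
  by apply/congruentP; rewrite uE sr.
have bw : ~ projsupp E (v + (- a) *: target r) b.
  by move=> /projsuppD [//|/projsuppZ].
have := positive_seq_rule (a + c) sr bw.
rewrite [X in positive_seq _ _ X](_ : _ = c *: target r + v); last first.
  by rewrite scalerDl scaleNr [a *: _ + _]addrC [v - _]addrC addrA addrK.
apply: positive_seq_trans; left; apply/congruentP.
rewrite linearD uE -linearD; congr (q _); rewrite [a + c]addrC.
by rewrite /defect sr scalerDl scaleNr scalerBr [in RHS]addrACA.
Qed.

Local Notation cls := (presented_class S).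

Lemma presented_class_congruent u v : congruent E u v -> cls u = cls v.
Proof.
case=> s uv; apply/quot_mapP; exists [seq (p.1, inr p.2) | p <- s].
by rewrite uv big_map.
Qed.

Lemma presented_class_rule r : cls (source r) = cls (target r).
Proof. by apply/quot_mapP; exists [:: (1, inl r)]; rewrite big_seq1 scale1r. Qed.

Lemma presented_class_step u w : positive_step S u w -> cls u = cls w.
Proof.
move=> [lam [r [v [[_ uv vw] _]]]].
rewrite (presented_class_congruent uv) -(presented_class_congruent vw).
rewrite /presented_class 2!quot_mapD 2!quot_map_scale.
by rewrite -![quot_map _ (_ r)]/(cls _) presented_class_rule.
Qed.

(** The difference is a finite sum of multiples of defects, added one at a time: one from R is
    handled by [joinable_rule], one from E is an E-congruence, and confluence chains the joins. *)
Lemma presented_class_joinable u v :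
  positive_confluent S -> cls u = cls v -> joinable u v.
Proof.
move=> conf /quot_mapP [s uv]; have -> : u = v + (u - v) by rewrite addrC subrK.
rewrite {}uv; elim: s => [|[a e] s IHs].
  by rewrite big_nil addr0; exists v; apply: positive_seq_refl.
apply: joinable_trans IHs => //; rewrite big_cons addrCA addrC.
case: e => [r | e] /=; first exact: joinable_rule.
exists (v + \sum_(p <- s) p.1 *: defect p.2); last exact: positive_seq_refl.
left; exists [:: (a, e)]; rewrite big_seq1 /=.
by rewrite [LHS]addrC addKr.
Qed.

End Rewriting.

(** * Independence and generation for a set of representatives *)

Section Basis.
Variables (k : comUnitRingType) (B : choiceType) (S : rewriting_modulo k B).
Local Notation E := (modulo S).
Local Notation cls := (presented_class S).
Hypothesis S_conv : positive_convergent S.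
Hypothesis E_coh : scalar_coherent E (monomial_nf S).
Variable T : set B.
Hypothesis T_repr : nf_representatives S T.
Local Notation family := (fun t : set_type T => cls << val t >>).

Let S_term : positive_terminating S := proj2 S_conv.

Lemma nf_val (t : set_type T) : monomial_nf S (val t).
Proof. by apply: (proj1 T_repr); apply: set_valP. Qed.

Lemma proj_congruent_val (t t' : set_type T) :
  proj_congruent E (val t) (val t') -> t = t'.
Proof.
move=> tt'; apply: val_inj; have [b [_ b_uniq]] := proj2 T_repr _ (@nf_val t).
rewrite -(b_uniq (val t')); last by split=> //; apply: set_valP.
by apply/esym/b_uniq; split; [apply: set_valP | apply: proj_congruent_refl].
Qed.

Lemma family_independent (c : {malg k[set_type T]}) :
  lin_comb family c = 0 -> c = 0.
Proof.
pose v : {malg k[B]} := lin_comb (fun t : set_type T => << val t >>) c.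
have coordE b : class_coord E b v = lin_comb (fun t : set_type T => proj_scalar E b (val t)) c.
  rewrite /v linear_lin_comb; apply: eq_bigr => t _ /=.
  by rewrite class_coordU.
have -> : lin_comb family c = cls v by rewrite /cls /v linear_lin_comb.
have -> : 0 = cls 0 by rewrite /cls linear0.
move=> /(presented_class_joinable (proj1 S_conv)) [w vw zw].
(* Both [v], a combination of normal forms, and 0 are irreducible, so the sequences joining them are
   E-congruences. *)
have irr_v : irreducible S v.
  move=> b bnf; rewrite coordE /lin_comb big1 // => t _.
  rewrite proj_scalar0 ?scaler0 // => tb; apply: bnf.
  exact: monomial_nf_proj_congruent tb (@nf_val t).
have irr_0 : irreducible S 0 by move=> b _; rewrite linear0.
have v0 : congruent E v 0.
  have := irreducible_seq S_term E_coh irr_v vw.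
  have := irreducible_seq S_term E_coh irr_0 zw.
  by rewrite !congruentP => <-.
apply/malgP => t; rewrite mcoeff0.
have := modulo_class_coord_congruent S_term E_coh (val t) v0; rewrite linear0 coordE => <-.
(* The index [t] may lie outside the support of [c], so it is adjoined before its term is isolated;
   the other representatives lie in other classes and contribute 0. *)
have : (msupp c `<=` t |` msupp c)%fset by apply: fsubsetU1.
move/(lin_combEw (fun t' : set_type T => proj_scalar E (val t) (val t'))) ->.
rewrite (big_fsetD1 t) ?fset1U1 //= big_seq big1 => [|t']; last first.
  rewrite in_fsetD1 => /andP[/eqP t't _]; rewrite proj_scalar0 ?scaler0 //.
  by move/proj_congruent_val.
by rewrite addr0 -class_coordU (class_coord_monomial S_term E_coh) [RHS]mulr1.
Qed.

Lemma nf_generated b : monomial_nf S b -> exists c, lin_comb family c = cls << b >>.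
Proof.
move=> bnf; have [b' [[b'T /proj_congruentP [lam _ bb']] _]] := proj2 T_repr b bnf.
exists (lam *: << SigSub (mem_set b'T) >>); rewrite linearZ /= lin_combU /=.
rewrite -quot_map_scale; apply/esym/presented_class_congruent/congruentP.
by rewrite bb' linearZ_LR.
Qed.

(** Induction on the size of the support: splitting off the class of a monomial [b] of the support
    removes at least [b]. *)
Lemma irreducible_generated v :
  irreducible S v -> exists c, lin_comb family c = cls v.
Proof.
have [n] := ubnP #|` msupp v|; elim: n v => // n IHn v vn v_irr.
have [v0|[b bv]] := fset_0Vmem (msupp v).
  have -> : v = 0 by apply/malgP => x; rewrite mcoeff0 mcoeff_outdom // v0.
  by exists 0; rewrite /presented_class !linear0.
have [v' [vE bv' v'v]] := class_coord_decomposition E b v.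
have v'_lt : (#|` msupp v'| < #|` msupp v|)%N.
  apply: fproper_ltn_card; rewrite fproperE; apply/andP; split; apply/fsubsetP => //.
  move=> /(_ b bv) b_in; apply: bv'; exists b => //.
  exact: proj_congruent_refl.
have classE : cls v = (class_coord E b v : k) *: cls << b >> + cls v'.
  by rewrite (presented_class_congruent vE) /presented_class quot_mapD quot_map_scale.
have v'_irr : irreducible S v'.
  (* At a reducible [x] the split-off term contributes 0: either [b] is a normal form, hence outside
     the class of [x], or its coefficient vanishes by [v_irr]. *)
  move=> x xnf; have := v_irr x xnf.
  rewrite (modulo_class_coord_congruent S_term E_coh x vE) linearP /= class_coordU.
  have [bnf|/v_irr ->] := pselect (monomial_nf S b); last by rewrite scale0r add0r.
  rewrite proj_scalar0 ?scaler0 ?add0r // => bx; apply: xnf.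
  exact: monomial_nf_proj_congruent bx bnf.
have [c' c'E] := IHn v' (leq_trans v'_lt vn) v'_irr.
have [bnf|bnf] := pselect (monomial_nf S b); last first.
  by exists c'; rewrite classE (v_irr b bnf) scale0r add0r.
have [c cE] := nf_generated bnf.
by exists ((class_coord E b v : k) *: c + c'); rewrite linearP /= cE c'E classE.
Qed.

(* A vector that is not generated is reducible, and a positive step keeps its
   class; so it would start an infinite sequence of positive steps. *)
Lemma family_generates v : exists c, lin_comb family c = cls v.
Proof.
pose generated u := exists c, lin_comb family c = cls u.
apply: contrapT => v_ngen.
have /choice [next nextP] : forall u, exists w,
    ~ generated u -> positive_step S u w /\ ~ generated w.
  move=> u.
  have [u_gen|u_ngen] := pselect (generated u); first by exists u.
  have [w uw] : exists w, positive_step S u w.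
    apply: contrapT => /nostep_irreducible.
    by move=> /irreducible_generated.
  exists w => _; split=> //; rewrite /generated.
  by rewrite -(presented_class_step uw).
have iter_ngen n : ~ generated (iter n next v).
  by elim: n => // n /nextP [].
by apply: S_term; exists (fun n => iter n next v) => n; case: (nextP _ (iter_ngen n)).
Qed.

Lemma family_basis : is_basis family.
Proof.
split=> [c|x]; first exact: family_independent.
by have [v <-] := quot_map_surj x; apply: family_generates.
Qed.

End Basis.

(** * Existence of representatives, and the theorem *)

Lemma nf_representatives_exist (k : comUnitRingType) (B : choiceType)
  (S : rewriting_modulo k B) : exists T, nf_representatives S T.
Proof.
pose cong b x := `[< proj_congruent (modulo S) b x >].
pose repr b := choose (cong b) b.
have cong_refl b : cong b b by apply/asboolP; apply: proj_congruent_refl.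
have reprP b : proj_congruent (modulo S) b (repr b).
  exact/asboolP/(chooseP (cong_refl b)).
have repr_eq b x : proj_congruent (modulo S) b x -> repr b = repr x.
  (* Canonicity of [choose]: [choose_id] replaces the default [b] by [x], then [eq_choose] replaces
     the class of [b] by the equal class of [x]. *)
  move=> bx; rewrite /repr (@choose_id _ (cong b) b x) //; last exact/asboolP.
  apply: eq_choose => y; apply/asboolP/asboolP; last exact: proj_congruent_trans.
  exact/proj_congruent_trans/proj_congruent_sym.
exists [set x | exists2 b, monomial_nf S b & x = repr b]%classic; split.
  by move=> _ [b bnf ->]; apply: monomial_nf_proj_congruent (reprP b) bnf.
move=> b bnf; exists (repr b); split; first by split=> //; exists b.
move=> _ [[x xnf ->] bx]; apply: etrans (repr_eq _ _ bx) _.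
by apply/esym/repr_eq/reprP.
Qed.

Theorem mainTheorem2 (k : comUnitRingType) (B : choiceType)
    (S : rewriting_modulo k B) :
  positive_convergent S ->
  scalar_coherent (modulo S) (monomial_nf S) ->
  is_free (presented_module S) /\
  forall T : set B, nf_representatives S T ->
    is_basis (fun b : set_type T => presented_class S << val b >>).
Proof.
move=> conv coh; split=> [|T T_repr]; last exact: family_basis.
have [T T_repr] := nf_representatives_exist S.
exists (set_type T), (fun t => presented_class S << val t >>).
exact: family_basis.
Qed.
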